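(* For any positive integers $n,m$, there exists an infinite family of distinct (that is, pairwise non-equivalent) virtual knot diagrams $D$ whose unknotting index, as diagrams, is $U(D)=(n,m)$.
   Context: A virtual knot diagram is a generic immersion of one circle in the plane whose double points are each marked either as a classical crossing (with over/under information) or as a virtual crossing (no over/under information). Two diagrams are equivalent if they are related by a finite sequence of classical Reidemeister moves RI, RII, RIII, virtual Reidemeister moves VRI, VRII, VRIII (the analogues of RI, RII, RIII in which all crossings are virtual), and the semi-virtual move SV (moving an arc having only virtual crossings across a classical crossing), together with planar isotopy. A virtual knot is an equivalence class of virtual knot diagrams. The trivial knot is the class of the crossingless circle. Virtualizing a classical crossing means replacing it by a virtual crossing; a crossing change means exchanging the over and under strands at a classical crossing. For non-negative integers $n,m$, a virtual knot diagram $D$ is $(n,m)$-unknottable if, by virtualizing $n$ classical crossings of $D$ and applying crossing changes at $m$ classical crossings of $D$, one obtains a diagram of the trivial knot. The unknotting index $U(D)$ of the diagram $D$ (for this fixed diagram, with no minimization over equivalent diagrams) is the minimum, in the dictionary (lexicographic) order, of all pairs $(n,m)$ such that $D$ is $(n,m)$-unknottable. *)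

(* Defs.v *)
From Stdlib Require Import Relations.
From mathcomp Require Import all_boot all_order.

Set Implicit Arguments.
Unset Strict Implicit.
Unset Printing Implicit Defensive.

(* A generic immersion of closed curves in the plane is put, by a planar
   isotopy, in general position with respect to the height function: its local
   minima, local maxima and double points lie at distinct heights, and at a
   double point neither branch is horizontal.  Read upwards it is a word in the
   events Cup (local minimum), Cap (local maximum) and Cross (double point).
   Two such words describe planar isotopic curves exactly when they are related
   by the moves of [isotopy_move] below, so planar isotopy is not built into the
   words but generated together with the Reidemeister moves. *)

(* [Classical true]: the branch going from lower left to upper right passes
   over; [Classical false]: the branch going from lower right to upper left
   passes over. *)
Inductive crossing := Classical of bool | Virtual.

Definition swap_over (c : crossing) : crossing :=
  if c is Classical b then Classical (~~ b) else Virtual.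

Inductive event := Cup | Cap | Cross of crossing.

Definition legs_below (e : event) : nat := if e is Cup then 0 else 2.
Definition legs_above (e : event) : nat := if e is Cap then 0 else 2.

(* [(e, i)]: the event [e] occurs with exactly [i] strands to its left. *)
Definition word := seq (event * nat).

(* Number of strands above [w], given [n] strands below it; [None] if some event
   involves strands that do not exist. *)
Fixpoint strands_above (n : nat) (w : word) : option nat :=
  if w is (e, i) :: w' then
    if i + legs_below e <= n
    then strands_above (n - legs_below e + legs_above e) w'
    else None
  else Some n.

Definition closed_word (w : word) : Prop := strands_above 0 w = Some 0.

(* The point [(h, p)] is where the [p]-th strand from the left meets the
   horizontal line lying just above the first [h] events. *)
Definition point := (nat * nat)%type.

Definition on_curve (w : word) (x : point) : Prop :=
  x.1 <= size w /\
  exists2 n, strands_above 0 (take x.1 w) = Some n & x.2 < n.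

(* Arcs of the curve between consecutive horizontal lines; at a double point of
   any kind each branch goes straight on. *)
Inductive arc (w : word) : point -> point -> Prop :=
| arc_left u e i v p : w = u ++ (e, i) :: v -> p < i ->
    arc w (size u, p) ((size u).+1, p)
| arc_right u e i v k : w = u ++ (e, i) :: v ->
    arc w (size u, i + legs_below e + k) ((size u).+1, i + legs_above e + k)
| arc_cup u i v : w = u ++ (Cup, i) :: v ->
    arc w ((size u).+1, i) ((size u).+1, i.+1)
| arc_cap u i v : w = u ++ (Cap, i) :: v ->
    arc w (size u, i) (size u, i.+1)
| arc_up_right u c i v : w = u ++ (Cross c, i) :: v ->
    arc w (size u, i) ((size u).+1, i.+1)
| arc_up_left u c i v : w = u ++ (Cross c, i) :: v ->
    arc w (size u, i.+1) ((size u).+1, i).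

(* The curve is the image of exactly one circle. *)
Definition one_circle (w : word) : Prop :=
  (exists x, on_curve w x) /\
  forall x y, on_curve w x -> on_curve w y ->
    clos_refl_sym_trans point (arc w) x y.

Record virtual_knot_diagram := VirtualKnotDiagram {
  diagram_word :> word;
  diagram_closed : closed_word diagram_word;
  diagram_one_circle : one_circle diagram_word }.

(* The codimension-one events of a planar isotopy with respect to height: two
   distant events exchange heights; a minimum and a maximum of one strand
   cancel; a branch through a double point becomes horizontal, so that the
   double point passes a minimum or a maximum (its branches then exchange their
   slopes, hence [swap_over]: the over branch stays over). *)
Inductive isotopy_move : word -> word -> Prop :=
| isotopy_exchange e f i k :
    isotopy_move [:: (e, i); (f, i + legs_above e + k)]
                 [:: (f, i + legs_below e + k); (e, i)]
| isotopy_zigzag_left i : isotopy_move [:: (Cup, i); (Cap, i.+1)] [::]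
| isotopy_zigzag_right i : isotopy_move [:: (Cup, i.+1); (Cap, i)] [::]
| isotopy_cup c i :
    isotopy_move [:: (Cup, i); (Cross c, i.+1)]
                 [:: (Cup, i.+1); (Cross (swap_over c), i)]
| isotopy_cap c i :
    isotopy_move [:: (Cross c, i); (Cap, i.+1)]
                 [:: (Cross (swap_over c), i.+1); (Cap, i)].

Definition kink_right (c : crossing) (i : nat) : word :=
  [:: (Cup, i.+1); (Cross c, i); (Cap, i.+1)].
Definition kink_left (c : crossing) (i : nat) : word :=
  [:: (Cup, i); (Cross c, i.+1); (Cap, i)].

(* The two sides of a triangle move on the strands which, from left to right,
   start at the bottom in positions [i], [i.+1], [i.+2]; [c12], [c13], [c23] are
   the crossings of the 1st and 2nd, the 1st and 3rd, the 2nd and 3rd strands. *)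
Definition triangle_before (c12 c13 c23 : crossing) (i : nat) : word :=
  [:: (Cross c12, i); (Cross c13, i.+1); (Cross c23, i)].
Definition triangle_after (c12 c13 c23 : crossing) (i : nat) : word :=
  [:: (Cross c23, i.+1); (Cross c13, i); (Cross c12, i.+1)].

(* In [RIII], [b12] says that the 1st strand passes over the 2nd, and so on; the
   side condition says that these three relations are not cyclic, i.e. that one
   strand is above and one below the two others.  In [SV1], [SV2], [SV3] the
   1st, 2nd, 3rd strand is the one having only virtual crossings. *)
Inductive reidemeister_move : word -> word -> Prop :=
| RI_right b i : reidemeister_move (kink_right (Classical b) i) [::]
| RI_left b i : reidemeister_move (kink_left (Classical b) i) [::]
| RII b i :
    reidemeister_move
      [:: (Cross (Classical b), i); (Cross (Classical (~~ b)), i)] [::]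
| RIII b12 b13 b23 i : (b13 == b12) || (b13 == b23) ->
    reidemeister_move
      (triangle_before (Classical b12) (Classical b13) (Classical b23) i)
      (triangle_after (Classical b12) (Classical b13) (Classical b23) i)
| VRI_right i : reidemeister_move (kink_right Virtual i) [::]
| VRI_left i : reidemeister_move (kink_left Virtual i) [::]
| VRII i : reidemeister_move [:: (Cross Virtual, i); (Cross Virtual, i)] [::]
| VRIII i :
    reidemeister_move (triangle_before Virtual Virtual Virtual i)
                      (triangle_after Virtual Virtual Virtual i)
| SV1 b i :
    reidemeister_move (triangle_before Virtual Virtual (Classical b) i)
                      (triangle_after Virtual Virtual (Classical b) i)
| SV2 b i :
    reidemeister_move (triangle_before Virtual (Classical b) Virtual i)
                      (triangle_after Virtual (Classical b) Virtual i)
| SV3 b i :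
    reidemeister_move (triangle_before (Classical b) Virtual Virtual i)
                      (triangle_after (Classical b) Virtual Virtual i).

(* [same_diagram] identifies diagrams that differ only in their proof fields. *)
Inductive diagram_move (D D' : virtual_knot_diagram) : Prop :=
| same_diagram : diagram_word D = diagram_word D' -> diagram_move D D'
| local_move u l r v :
    diagram_word D = u ++ l ++ v -> diagram_word D' = u ++ r ++ v ->
    isotopy_move l r \/ reidemeister_move l r -> diagram_move D D'.

Definition equivalent : relation virtual_knot_diagram :=
  clos_refl_sym_trans virtual_knot_diagram diagram_move.

Definition circle_word : word := [:: (Cup, 0); (Cap, 0)].

Lemma circle_closed : closed_word circle_word.
Proof. by []. Qed.

Lemma circle_one_circle : one_circle circle_word.
Proof.
have join01 : arc circle_word (1, 0) (1, 1).
  exact: (@arc_cup circle_word [::] 0 [:: (Cap, 0)]).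
split; first by exists (1, 0); split=> //; exists 2.
have at1 x : on_curve circle_word x -> x = (1, 0) \/ x = (1, 1).
  case: x => [[|[|[|h]]] p] [//= _ [n [<-]]] //.
  by case: p => [|[|p]] // _; [left | right].
move=> x y /at1[] -> /at1[] ->; try exact: rst_refl.
- exact: rst_step.
- exact/rst_sym/rst_step.
Qed.

Definition trivial_diagram : virtual_knot_diagram :=
  VirtualKnotDiagram circle_closed circle_one_circle.

(* [alter n m w w']: [w'] is [w] with [n] classical crossings virtualized and
   crossing changes applied at [m] other classical crossings. *)
Inductive alter : nat -> nat -> word -> word -> Prop :=
| alter_nil : alter 0 0 [::] [::]
| alter_keep n m x w w' : alter n m w w' -> alter n m (x :: w) (x :: w')
| alter_virtualize n m b i w w' : alter n m w w' ->
    alter n.+1 m ((Cross (Classical b), i) :: w) ((Cross Virtual, i) :: w')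
| alter_change n m b i w w' : alter n m w w' ->
    alter n m.+1 ((Cross (Classical b), i) :: w)
                 ((Cross (Classical (~~ b)), i) :: w').

Definition unknottable (D : virtual_knot_diagram) (n m : nat) : Prop :=
  exists D' : virtual_knot_diagram,
    alter n m D D' /\ equivalent D' trivial_diagram.

(* [nat *l nat] carries the lexicographic order. *)
Definition unknotting_index (D : virtual_knot_diagram) (p : nat *l nat) : Prop :=
  unknottable D p.1 p.2 /\
  forall q : nat *l nat, unknottable D q.1 q.2 -> (p <= q)%O.

(* Main.v *)
(* Colour every strand by an orientation and an integer label.  At a classical
   crossing each label moves by 2, in a direction given by the orientation of
   the other strand and regardless of which strand is over; at a virtual
   crossing the labels do not change.  The two labels at a classical crossing
   then determine twice its index W, and for every f with f 0 = 0 the sum of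
   sign * f(W) over the classical crossings of a coloured diagram is invariant
   under all moves.  For odd f it is also insensitive to crossing changes.

   The k-th diagram carries, along one strand, n hooked kinks and m kinks
   containing a clasp.  A hooked kink is a kink inside a kink, whose inner loop
   is met by the outgoing strand in one classical and in virtual crossings; its
   crossings have W = 2, 2, -4.  For f = [W = -4] - [W = 4] it contributes 1,
   but 0 as soon as one of its crossings is virtualized, while the clasps
   contribute 0 whatever is done to their crossings.  Hence each of the n hooked
   kinks must lose a crossing.  If no more than n crossings are virtualized, the
   clasps keep all theirs; each clasp contributes 1 to the number of crossings,
   counted with sign, that have W = 4k + 6, and one crossing change lowers this
   number by at most 1, so m changes are needed.  This number also distinguishes
   the diagrams.  Conversely, once the hook of each hooked kink is virtualized
   and one crossing of each clasp is changed, everything cancels by moves that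
   remove bigons and kinks. *)

Require Import Defs.
From mathcomp Require Import all_boot all_order.
From Stdlib Require Import Relations ZArith Lia.
From mathcomp Require Import zify_ssreflect.

Set Implicit Arguments.
Unset Strict Implicit.
Unset Printing Implicit Defensive.

Local Arguments Z.add : simpl never.
Local Arguments Z.sub : simpl never.
Local Arguments Z.mul : simpl never.

(** * Coloured diagrams *)

Definition color := (bool * Z)%type.

Definition sgn (b : bool) : Z := if b then 1%Z else (-1)%Z.

Definition turned (c : color) : color := (~~ c.1, c.2).

(* [c] comes from the lower left and [d] from the lower right.  The index is a
   difference of labels half way through the crossing; steps of 2 keep these
   middle labels integral. *)
Definition crossed (x : crossing) (c d : color) : color * color :=
  if x is Classical _
  then ((d.1, d.2 - 2 * sgn c.1)%Z, (c.1, c.2 + 2 * sgn d.1)%Z)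
  else (d, c).

(** The three signs multiply to the sign of the crossing. The argument of [f] is its [W]: the label
    of the over strand minus that of the under strand, both taken half way through. *)
Definition weight (f : Z -> Z) (x : crossing) (c d : color) : Z :=
  if x is Classical b
  then (sgn b * sgn c.1 * sgn d.1 *
        f (sgn b * (c.2 - d.2 + sgn c.1 + sgn d.1)))%Z
  else 0%Z.

(* [step] and [run] are in continuation style: [run f w s a K] says that the
   strands coloured [s] below [w] can be coloured throughout [w], so that [K]
   holds of the colours above [w] and of the value obtained by adding to [a] the
   weights of the crossings of [w]. *)
Fixpoint step f (e : event) (i : nat) (s : seq color) (a : Z)
    (K : seq color -> Z -> Prop) : Prop :=
  match i, s with
  | j.+1, c :: t => step f e j t a (fun t' => K (c :: t'))
  | _.+1, [::] => False
  | 0, _ =>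
    match e, s with
    | Cup, _ => exists c, K (c :: turned c :: s) a
    | Cap, c :: d :: t => d = turned c /\ K t a
    | Cross x, c :: d :: t =>
      K ((crossed x c d).1 :: (crossed x c d).2 :: t) (a + weight f x c d)%Z
    | _, _ => False
    end
  end.

Fixpoint run f (w : word) (s : seq color) (a : Z)
    (K : seq color -> Z -> Prop) : Prop :=
  if w is (e, i) :: w' then step f e i s a (fun s' b => run f w' s' b K)
  else K s a.

Lemma step_iff f e i s a K K' :
  (forall s' b, i + legs_below e <= size s ->
     size s' = size s - legs_below e + legs_above e -> K s' b <-> K' s' b) ->
  step f e i s a K <-> step f e i s a K'.
Proof.
elim: i s K K' => [|i IHi] [|c s] K K' eqK //=.
- case: e eqK => //= eqK; split=> -[c] /eqK Kc; exists c; exact: Kc.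
- case: e eqK => [||x] eqK.
  + by split=> -[d] /eqK Kd; exists d; apply: Kd => //=; lia.
  + by case: s eqK => // d s eqK; split=> -[-> /eqK Kd]; split=> //;
      apply: Kd => //=; lia.
  + by case: s eqK => // d s eqK; apply: eqK => //=; lia.
by apply: IHi => s' b le_i eq_s'; apply: eqK => /=; lia.
Qed.

(** Restricting to stacks of the right height lets a local equality, valid only where the move fits,
    be used inside a longer word. *)
Lemma run_iff f w s a K K' :
  (forall s' b, strands_above (size s) w = Some (size s') ->
     K s' b <-> K' s' b) ->
  run f w s a K <-> run f w s a K'.
Proof.
elim: w s a => [|[e i] w IHw] s a eqK /=; first exact: eqK.
apply: step_iff => s' b le_i eq_s'; apply: IHw => s2 b2 eq_s2; apply: eqK.
by rewrite /= le_i -eq_s'.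
Qed.

Lemma run_cat f u w s a K :
  run f (u ++ w) s a K <-> run f u s a (fun s' b => run f w s' b K).
Proof.
by elim: u s a => [|[e i] u IHu] s a //=; apply: step_iff => s' b _ _.
Qed.

(** The choice at a cup, the equation at a cap and the weight of a crossing commute with any distant
    event: [step_exists], [step_and] and [step_add] give the three cases of an exchange of
    heights. *)
Lemma step_exists f e i s a (T : Type) (K : T -> seq color -> Z -> Prop) :
  step f e i s a (fun s' b => exists x, K x s' b) <->
  exists x, step f e i s a (K x).
Proof.
elim: i s K => [|i IHi] [|c s] K //=; last by split=> // -[].
- by case: e => [||x]; [split=> -[x [y]] ?; exists y, x | split=> // -[] ..].
case: e => [||x].
- by split=> -[x [y]] ?; exists y, x.
- case: s => [|d s]; first by split=> // -[].
  by split=> [[-> [x Kx]]|[x [-> Kx]]]; [exists x | split=> //; exists x].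
- by case: s => // ; split=> // -[].
Qed.

Lemma step_and f e i s a (P : Prop) K :
  step f e i s a (fun s' b => P /\ K s' b) <-> P /\ step f e i s a K.
Proof.
elim: i s K => [|i IHi] [|c s] K //=; try tauto.
- case: e => [||x]; try tauto; firstorder.
- case: e => [||x]; last (by case: s; tauto); first firstorder.
  by case: s; tauto.
Qed.

Lemma step_add f e i s a b K :
  step f e i s (a + b)%Z K <-> step f e i s a (fun s' x => K s' (x + b)%Z).
Proof.
elim: i s K => [|i IHi] [|c s] K //=.
by case: e s => [||x] [|d s] //; rewrite -!Z.add_assoc (Z.add_comm b).
Qed.

(** * Translation of words to the right *)

Definition up (x : event * nat) := (x.1, x.2.+1).

Lemma run_up f w c t a K :
  run f (map up w) (c :: t) a K <-> run f w t a (fun t' => K (c :: t')).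
Proof.
by elim: w t a => [|[e i] w IHw] t a //=; apply: step_iff.
Qed.

Lemma strands_above_up n w :
  strands_above n.+1 (map up w) = omap S (strands_above n w).
Proof.
elim: w n => [|[e i] w IHw] n //=; rewrite addSn ltnS.
by case: ifP => // le_i; rewrite -IHw; congr strands_above; lia.
Qed.

(** On too few strands the run of [l] is false while that of an empty [r] need not be; hence [l] is
    required to fit. *)
Definition run_equal f l r := forall s a K, strands_above (size s) l ->
  run f l s a K <-> run f r s a K.

Lemma run_equal_up f l r : l <> [::] -> run_equal f l r ->
  run_equal f (map up l) (map up r).
Proof.
case: l => // -[e i] l _ eq_lr [|c s] a K; first by [].
rewrite [size _]/= strands_above_up => fits; rewrite !run_up; apply: eq_lr.
by move: fits; case: strands_above.
Qed.

Lemma run_equal_shift f (L R : nat -> word) :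
    (forall i, L i <> [::]) ->
    (forall i, L i.+1 = map up (L i)) -> (forall i, R i.+1 = map up (R i)) ->
    run_equal f (L 0) (R 0) ->
  forall i, run_equal f (L i) (R i).
Proof.
move=> L_neq0 LS RS eq0; elim=> // i IHi.
by rewrite LS RS; apply: run_equal_up.
Qed.

Lemma run_equal_exchange f e e' i k :
  run_equal f [:: (e, i); (e', i + legs_above e + k)]
              [:: (e', i + legs_below e + k); (e, i)].
Proof.
apply: (run_equal_shift (L := fun i => [:: (e, i); (e', i + legs_above e + k)])
  (R := fun i => [:: (e', i + legs_below e + k); (e, i)])) => // s a K.
rewrite !add0n; case: e => [||x].
- by rewrite /= ?add0n ?add2n /= step_exists.
- case: s => [|c [|d s]] // _.
  by rewrite /= step_and.
- case: s => [|c [|d s]] // _.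
  by rewrite /= step_add.
Qed.

Lemma state_eq (K : seq color -> Z -> Prop) s s' a a' :
  s = s' -> a = a' -> K s a -> K s' a'.
Proof. by move=> -> ->. Qed.

Lemma sgn_negb b : sgn (~~ b) = (- sgn b)%Z.
Proof. by case: b. Qed.

(* [f0] is a proof of [f 0 = 0], or a dummy if that equation is not needed. *)
Ltac equal_runs f f0 :=
  rewrite /= ?sgn_negb;
  repeat match goal with
  | |- context [f ?x] => match goal with |- context [f ?y] =>
      first [constr_eq x y; fail 1
            | replace (f x) with (f y) by (f_equal; lia)] end
  end;
  repeat match goal with
  | |- context [f ?x] => replace (f x) with 0%Z
      by (rewrite -f0; f_equal; lia) end;
  apply: state_eq; repeat first [lia | f_equal].

(** * Invariance under isotopy and Reidemeister moves *)

Lemma run_equal_cup f c :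
  run_equal f [:: (Cup, 0); (Cross c, 1)]
              [:: (Cup, 1); (Cross (swap_over c), 0)].
Proof.
move=> [|[o x] s] a K //= _.
case: c => [b|] //=; rewrite /crossed /turned /weight /=; split=> -[[p y] /= H].
(* The label of the new branch is read on one side or the other of the strand that it crosses, a
   difference of [2 * sgn o]. *)
- exists (p, (y + 2 * sgn o)%Z).
  by move: H; equal_runs f I.
- exists (p, (y - 2 * sgn o)%Z).
  by move: H; equal_runs f I.
Qed.

Lemma run_equal_cap f c :
  run_equal f [:: (Cross c, 0); (Cap, 1)]
              [:: (Cross (swap_over c), 1); (Cap, 0)].
Proof.
move=> [|[o x] [|[p y] [|[q z] s]]] a K //= _.
case: c => [b|] //=; rewrite /crossed /turned /weight /=.
by split=> -[[e1 e2] H]; split; move: e1 e2 H => -> e2 H;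
  first [f_equal; rewrite ?sgn_negb; lia | move: H; equal_runs f I].
Qed.

Lemma run_equal_isotopy f l r : isotopy_move l r -> run_equal f l r.
Proof.
case.
- exact: run_equal_exchange.
- apply: (@run_equal_shift f (fun i => [:: (Cup, i); (Cap, i.+1)]) (fun=> [::]))
    => // -[|[o x] s] a K //= _; rewrite /turned; split.
    by move=> [[p y]] [[-> ->]]; rewrite /= negbK.
  by move=> Ks; exists (o, x); rewrite /= negbK.
- apply: (@run_equal_shift f (fun i => [:: (Cup, i.+1); (Cap, i)]) (fun=> [::]))
    => // -[|[o x] s] a K //= _; rewrite /turned; split.
    by move=> [[p y]] [[-> ->]]; rewrite /= negbK.
  by move=> Ks; exists (~~ o, x); rewrite /= negbK.
- move=> c; apply: (@run_equal_shift f
    (fun i => [:: (Cup, i); (Cross c, i.+1)])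
    (fun i => [:: (Cup, i.+1); (Cross (swap_over c), i)])) => //.
  exact: run_equal_cup.
- move=> c; apply: (@run_equal_shift f
    (fun i => [:: (Cross c, i); (Cap, i.+1)])
    (fun i => [:: (Cross (swap_over c), i.+1); (Cap, i)])) => //.
  exact: run_equal_cap.
Qed.

(** The cap forces the two middle labels at a classical crossing to agree, so [W = 0] there and the
    weight vanishes. *)
Lemma run_equal_kink_right f c : f 0%Z = 0%Z ->
  run_equal f (kink_right c 0) [::].
Proof.
move=> f0 [|[o x] s] a K //= _; rewrite /turned; split.
  move=> [[p y]] /=; case: c => [b|] /= [[e1 e2]]; move: e1 e2;
    last by move=> /negb_inj -> <-; rewrite Z.add_0_r.
  by move=> /negb_inj -> e2; equal_runs f f0.
case: c => [b|] Ks; last by exists (o, x); rewrite /= Z.add_0_r.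
exists (o, (x + 2 * sgn o)%Z); split=> //=.
by move: Ks; equal_runs f f0.
Qed.

Lemma run_equal_kink_left f c : f 0%Z = 0%Z ->
  run_equal f (kink_left c 0) [::].
Proof.
move=> f0 [|[o x] s] a K //= _; rewrite /turned; split.
  move=> [[p y]] /=; case: c => [b|] /= [[e1 e2]]; move: e1 e2;
    last by move=> -> ->; rewrite Z.add_0_r.
  by move=> ->; rewrite sgn_negb => e2; equal_runs f f0.
case: c => [b|] Ks; last by exists (~~ o, x); rewrite /= negbK Z.add_0_r.
exists (~~ o, (x - 2 * sgn o)%Z); split=> /=.
  by rewrite !negbK.
by move: Ks; equal_runs f f0.
Qed.

Lemma run_equal_bigon f b :
  run_equal f [:: (Cross (Classical b), 0); (Cross (Classical (~~ b)), 0)] [::].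
Proof.
move=> [|[o x] [|[p y] s]] a K //= _.
by split; equal_runs f I.
Qed.

(** Each of the three crossings keeps its sign and its [W]; only the order of the summands
    changes. *)
Lemma run_equal_triangle f b12 b13 b23 :
  let c12 := Classical b12 in
  let c13 := Classical b13 in
  let c23 := Classical b23 in
  run_equal f (triangle_before c12 c13 c23 0) (triangle_after c12 c13 c23 0).
Proof.
move=> /= [|[o x] [|[p y] [|[q z] s]]] a K //= _.
by split; equal_runs f I.
Qed.

Lemma run_equal_reidemeister f l r : f 0%Z = 0%Z ->
  reidemeister_move l r -> run_equal f l r.
Proof.
move=> f0 [].
- move=> b.
  apply: (@run_equal_shift f (kink_right (Classical b)) (fun=> [::])) => //.
  exact: run_equal_kink_right.
- move=> b.
  apply: (@run_equal_shift f (kink_left (Classical b)) (fun=> [::])) => //.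
  exact: run_equal_kink_left.
- move=> b; apply: (@run_equal_shift f
    (fun i => [:: (Cross (Classical b), i); (Cross (Classical (~~ b)), i)])
    (fun=> [::])) => //.
  exact: run_equal_bigon.
- move=> b12 b13 b23 i _.
  exact: (@run_equal_shift f
    (triangle_before _ _ _) (triangle_after _ _ _) _ _ _
    (@run_equal_triangle f b12 b13 b23)).
- apply: (@run_equal_shift f (kink_right Virtual) (fun=> [::])) => //.
  exact: run_equal_kink_right.
- apply: (@run_equal_shift f (kink_left Virtual) (fun=> [::])) => //.
  exact: run_equal_kink_left.
- apply: (@run_equal_shift f
    (fun i => [:: (Cross Virtual, i); (Cross Virtual, i)])
    (fun=> [::])) => // -[|[o x] [|[p y] s]] a K //= _.
  by rewrite !Z.add_0_r.
- apply: (@run_equal_shift f (triangle_before _ _ _)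
    (triangle_after _ _ _)) => //.
- move=> b; apply: (@run_equal_shift f (triangle_before _ _ _)
    (triangle_after _ _ _)) => //.
  by move=> -[|[o x] [|[p y] [|[q z] s]]] a K //= _; rewrite !Z.add_0_r.
- move=> b; apply: (@run_equal_shift f (triangle_before _ _ _)
    (triangle_after _ _ _)) => //.
- move=> b; apply: (@run_equal_shift f (triangle_before _ _ _)
    (triangle_after _ _ _)) => //.
  by move=> -[|[o x] [|[p y] [|[q z] s]]] a K //= _; rewrite !Z.add_0_r.
Qed.

Lemma strands_above_cat n u w :
  strands_above n (u ++ w) = obind (strands_above^~ w) (strands_above n u).
Proof. by elim: u n => [|[e i] u IHu] n //=; case: ifP. Qed.

(** A relation and not a function, since reversing the orientation can change the value: for
    [flat_indicator] a hooked kink gives 1 or -1. *)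
Definition closed_value f w v :=
  run f w [::] 0%Z (fun s a => s = [::] /\ a = v).

Lemma closed_value_equivalent f (D D' : virtual_knot_diagram) v :
  f 0%Z = 0%Z -> equivalent D D' -> closed_value f D v <-> closed_value f D' v.
Proof.
move=> f0; elim=> {D D'} [D D' | // | D D' _ -> // | D1 D2 D3 _ -> _ -> //].
case=> [-> // | u l r w Dl Dr mv]; rewrite /closed_value Dl Dr !run_cat.
apply: run_iff => s b eq_s; rewrite !run_cat.
have fits: strands_above (size s) l.
  have := diagram_closed D; rewrite /closed_word Dl strands_above_cat eq_s /=.
  by rewrite strands_above_cat; case: strands_above.
by case: mv => [/run_equal_isotopy|/(run_equal_reidemeister f0)]; apply.
Qed.

Lemma closed_value_trivial f (D : virtual_knot_diagram) v :
  f 0%Z = 0%Z -> equivalent D trivial_diagram -> closed_value f D v -> v = 0%Z.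
Proof.
move=> f0 /(closed_value_equivalent v f0) eqv /eqv.
by case=> c [_ [_ ->]].
Qed.

(** * Hooked kinks and clasps *)

Definition classical (x : crossing) : bool :=
  if x is Classical _ then true else false.

Definition crossing_value (f : Z -> Z) (x : crossing) (e : Z) : Z :=
  if x is Classical b then (sgn b * f (sgn b * e))%Z else 0%Z.

(* [x] and [y] are the crossings of the outer and of the inner kink; [z] is the
   one where the outgoing strand of the outer kink meets the inner loop, which
   it reaches and leaves through virtual crossings. *)
Definition hooked_kinks (x y z : crossing) : word :=
  [:: (Cup, 1); (Cross x, 0); (Cup, 2); (Cross y, 1);
      (Cross Virtual, 0); (Cross z, 1); (Cross Virtual, 1); (Cross Virtual, 0);
      (Cap, 2); (Cap, 1)].

Lemma sgn_sqr b : (sgn b * sgn b = 1)%Z.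
Proof. by case: b. Qed.

(** In the Gauss diagram the chord of [z] meets those of [x] and [y], which do not meet each other;
    each classical chord that is met contributes 2 or -2 to [W]. *)
Definition hooked_value f x y z (o : bool) : Z :=
  let n c := (2 * sgn o * Z.b2z (classical c))%Z in
  (crossing_value f x (n z) + crossing_value f y (n z)
   + crossing_value f z (- n x - n y))%Z.

Lemma run_hooked_kinks f x y z c t a K :
  run f (hooked_kinks x y z) (c :: t) a K <->
  K (c :: t) (a + hooked_value f x y z c.1)%Z.
Proof.
case: c => o l; rewrite /= /turned; split.
  move=> [[p u] [[q v] /=]].
  by case: x => [bx|]; case: y => [yb|]; case: z => [bz|];
    rewrite /crossed /hooked_value /= => -[[e1 e2]] [[e3 e4]];
    move: e1 e3 e2 e4 => /negb_inj -> /negb_inj -> e2 e4; move: e2 e4;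
    case: o; change (sgn true) with 1%Z; change (sgn false) with (-1)%Z
      => e2 e4; equal_runs f I.
move=> H.
(* The colours of the outer and of the inner cup, solved from the two cap equations. *)
exists (o, l + 2 * sgn o * (Z.b2z (classical x) - Z.b2z (classical z)))%Z.
exists (o, l + 2 * sgn o * (Z.b2z (classical x) + Z.b2z (classical y)
                            - Z.b2z (classical z)))%Z.
by move: H; case: x => [bx|]; case: y => [yb|]; case: z => [bz|];
  rewrite /crossed /hooked_value /=;
  case: o; change (sgn true) with 1%Z; change (sgn false) with (-1)%Z
  => H; (split; [f_equal; lia|]; split; [f_equal; lia|]; move: H;
    equal_runs f I).
Qed.

(** * Twists of two strands and the kinks made of them *)

Definition twist (ls : seq crossing) : word := [seq (Cross c, 0) | c <- ls].

Definition kink (ls : seq crossing) : word :=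
  (Cup, 1) :: twist ls ++ [:: (Cap, 1)].

(* Here [e] stands for [x - y + 2 * sgn o], where [x], [y] are the labels of two
   strands twisted around each other, both of orientation [o]. *)
Definition crossing_act (o : bool) (c : crossing) (e : Z) : Z :=
  if c is Classical _ then (- e)%Z else (4 * sgn o - e)%Z.

Fixpoint twist_end o ls e : Z :=
  if ls is c :: ls' then twist_end o ls' (crossing_act o c e) else e.

Fixpoint twist_value f o ls e : Z :=
  if ls is c :: ls'
  then (crossing_value f c e + twist_value f o ls' (crossing_act o c e))%Z
  else 0%Z.

Lemma twist_end_cat o u w e :
  twist_end o (u ++ w) e = twist_end o w (twist_end o u e).
Proof. by elim: u e => //=. Qed.

Lemma twist_value_cat f o u w e :
  twist_value f o (u ++ w) e =
  (twist_value f o u e + twist_value f o w (twist_end o u e))%Z.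
Proof. by elim: u e => //= c u IHu e; rewrite IHu Z.add_assoc. Qed.

(** Every crossing of two strands of equal orientation preserves the sum of their labels, so only
    the difference, recorded by [e], evolves. *)
Lemma run_twist f o ls x y t a K :
  run f (twist ls) ((o, x) :: (o, y) :: t) a K <->
  exists x' y', [/\ (x' + y' = x + y)%Z,
    (x' - y' + 2 * sgn o = twist_end o ls (x - y + 2 * sgn o))%Z &
    K ((o, x') :: (o, y') :: t)
      (a + twist_value f o ls (x - y + 2 * sgn o))%Z].
Proof.
elim: ls x y a => [|c ls IHls] x y a /=.
  rewrite Z.add_0_r; split=> [|[x' [y' []]]]; first by exists x, y.
  by move=> e1 e2 H; move: H; apply: state_eq; repeat first [lia | f_equal].
case: c => [b|] /=; rewrite IHls.
  have -> : (y - 2 * sgn o - (x + 2 * sgn o) + 2 * sgn o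
             = - (x - y + 2 * sgn o))%Z by lia.
  have -> : (x - y + sgn o + sgn o = x - y + 2 * sgn o)%Z by lia.
  have -> : (sgn b * sgn o * sgn o = sgn b)%Z.
    by rewrite -Z.mul_assoc sgn_sqr Z.mul_1_r.
  by split=> -[x' [y' [e1 e2 H]]]; exists x', y'; split=> //;
    first [lia | move: H; rewrite -!Z.add_assoc].
have -> : (y - x + 2 * sgn o = 4 * sgn o - (x - y + 2 * sgn o))%Z by lia.
by split=> -[x' [y' [e1 e2 H]]]; exists x', y'; split=> //;
  first [lia | move: H; rewrite -!Z.add_assoc].
Qed.

(** An odd twist exchanges the two orientations; the cap of a kink then forces them to be equal. *)
Lemma run_twist_swaps f o p ls x y t a K : odd (size ls) ->
  run f (twist ls) ((o, x) :: (p, y) :: t) a K ->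
  exists x' y' v, K ((p, x') :: (o, y') :: t) v.
Proof.
suff gen b : run f (twist ls) ((o, x) :: (p, y) :: t) b K ->
    exists x' y' v, K ((if odd (size ls) then p else o, x')
      :: (if odd (size ls) then o else p, y') :: t) v.
  by move=> odd_ls /gen; rewrite odd_ls.
elim: ls o p x y b => [|c ls IHls] o p x y b /=; first by exists x, y, b.
by case: c => [s|] /= /IHls; case: odd.
Qed.

(** The cap asks the right strand to leave the twist with the label it had at the cup. As the sum of
    labels is preserved, this makes [e] a fixed point of the twist. *)
Lemma run_kink f ls c t a K : odd (size ls) ->
  run f (kink ls) (c :: t) a K <->
  exists2 e, twist_end c.1 ls e = e &
    K (c :: t) (a + twist_value f c.1 ls e)%Z.
Proof.
case: c => o x odd_ls; rewrite /kink [run f _ _ _ _]/=; split.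
  move=> [[p z] ]; rewrite /turned run_cat /= => H.
  have eq_op: p = o.
    by have [x' [y' [v /= [[]]]]] := run_twist_swaps odd_ls H => /negb_inj.
  move: H; rewrite eq_op run_twist => -[x' [y' [e1 e2 /= [[e3] H]]]].
  exists (x - z + 2 * sgn o)%Z; first by rewrite -e2; lia.
  by move: H; apply: state_eq; repeat first [lia | f_equal].
move=> [e end_e H]; exists (o, x + 2 * sgn o - e)%Z.
rewrite run_cat /= /turned run_twist.
exists x, (x + 2 * sgn o - e)%Z.
have -> : (x - (x + 2 * sgn o - e) + 2 * sgn o = e)%Z by lia.
by rewrite end_e.
Qed.

Definition over_cross := Classical true.

(* Each conjugation raises the index of the crossings inside by 2, while the two
   crossings it adds cancel each other in all sums. *)
Fixpoint conjugated (k : nat) (ls : seq crossing) : seq crossing :=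
  if k is k'.+1
  then [:: over_cross; Virtual] ++ conjugated k' ls ++
       [:: Virtual; Classical false]
  else ls.

(** For [c = over_cross] the two inner crossings have equal signs and opposite [W]; for
    [c = Classical false] they bound a bigon. The last virtual crossing makes the number of
    crossings odd and the twist the reflection with fixed point [2 * sgn o]. *)
Definition clasp k (c : crossing) : seq crossing :=
  rcons (conjugated k [:: over_cross; c]) Virtual.

Lemma twist_end_conjugated o k ls e :
  (forall e, twist_end o ls e = e) -> twist_end o (conjugated k ls) e = e.
Proof.
move=> end_ls; elim: k e => //= k IHk e.
by rewrite twist_end_cat IHk /=; lia.
Qed.

Lemma twist_value_conjugated f o k ls e :
  (forall e, twist_end o ls e = e) ->
  twist_value f o (conjugated k ls) e =
  twist_value f o ls (e + 4 * sgn o * Z.of_nat k)%Z.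
Proof.
move=> end_ls; elim: k e => [|k IHk] e.
  by congr twist_value; rewrite Z.mul_0_r Z.add_0_r.
rewrite [LHS]/= twist_value_cat IHk twist_end_conjugated // [LHS]/= Z.add_0_r.
have -> : (4 * sgn o - - e + 4 * sgn o * Z.of_nat k =
           e + 4 * sgn o * Z.of_nat k.+1)%Z by lia.
have -> : (sgn true * e = e)%Z by rewrite /sgn; lia.
have -> : (sgn false * (4 * sgn o - (4 * sgn o - - e)) = e)%Z.
  by rewrite /(sgn false); lia.
by rewrite /(sgn true) /(sgn false); lia.
Qed.

Lemma size_conjugated k ls : odd (size (conjugated k ls)) = odd (size ls).
Proof. by elim: k => //= k IHk; rewrite size_cat oddD IHk /= addbF negbK. Qed.

Lemma odd_clasp k c : odd (size (clasp k c)).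
Proof. by rewrite size_rcons /= size_conjugated. Qed.

(** The fixed point 2 of an upward clasp, translated by 4 for each of the [k] conjugations. *)
Definition clasp_index (k : nat) : Z := (4 * Z.of_nat k + 2)%Z.

Lemma clasp_fixed o k b e :
  twist_end o (clasp k (Classical b)) e = e -> e = (2 * sgn o)%Z.
Proof.
rewrite /clasp -cats1 twist_end_cat twist_end_conjugated /=;
  last by move=> x; lia.
lia.
Qed.

Lemma twist_value_clasp f o k :
  twist_value f o (clasp k over_cross) (2 * sgn o)
  = (f (clasp_index k) + f (- clasp_index k))%Z.
Proof.
rewrite /clasp -cats1 twist_value_cat twist_value_conjugated /=;
  last by move=> x; lia.
rewrite /clasp_index.
case: o; rewrite /sgn !Z.add_0_r !Z.mul_1_l; last rewrite Z.add_comm;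
  by congr (f _ + f _)%Z; lia.
Qed.

Lemma run_clasp f k c t a K :
  run f (kink (clasp k over_cross)) (c :: t) a K <->
  K (c :: t) (a + (f (clasp_index k) + f (- clasp_index k)))%Z.
Proof.
rewrite run_kink ?odd_clasp // -(twist_value_clasp _ c.1).
split=> [[e /clasp_fixed ->] //|H]; exists (2 * sgn c.1)%Z => //.
rewrite /clasp -cats1 twist_end_cat twist_end_conjugated /=;
  last by move=> x; lia.
by lia.
Qed.

Definition indicator (n W : Z) : Z := if (W =? n)%Z then 1%Z else 0%Z.

(** An odd function: a crossing change, which reverses both the sign and [W], does not affect its
    sums. *)
Definition flat_indicator (W : Z) : Z := (indicator (-4) W - indicator 4 W)%Z.

(** Each crossing acts by one of the reflections [- e] and [4 - e]; an odd composite is a reflection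
    [4 * z - e], fixing [2 * z]. *)
Lemma odd_twist_fixed ls : odd (size ls) -> exists e, twist_end true ls e = e.
Proof.
suff gen : exists z, forall e,
    twist_end true ls e = (4 * z + (if odd (size ls) then - e else e))%Z.
  by case: gen => z gen odd_ls; exists (2 * z)%Z; rewrite gen odd_ls; lia.
elim: ls => [|c ls [z IHls]] /=; first by exists 0%Z.
case: c => [b|]; first by exists z => e; rewrite IHls /=; case: odd => /=; lia.
exists (z + if odd (size ls) then -1 else 1)%Z => e; rewrite IHls /= /sgn.
by case: odd => /=; lia.
Qed.

(* [phi] is a potential: [phi (4 - e) = phi e], and [phi (- e) - phi e] is
   [flat_indicator e]. *)
Lemma flat_twist_value ls e :
  let phi e := (indicator 0 e + indicator 4 e)%Z in
  twist_value flat_indicator true ls e = (phi (twist_end true ls e) - phi e)%Z.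
Proof.
move=> phi; elim: ls e => [|c ls IHls] e /=; first lia.
rewrite IHls; set p := phi (twist_end _ _ _); rewrite {}/p /phi.
case: c => [b|];
  rewrite /crossing_value /crossing_act /flat_indicator /indicator.
  by case: b; rewrite /sgn; repeat case: Z.eqb_spec; lia.
by rewrite /sgn; repeat case: Z.eqb_spec; lia.
Qed.

(** * Altered diagrams *)

(** Only the existence of a colouring is kept, and only for an upward strand: one nonzero value is
    enough to exclude triviality. *)
Definition passes f w v := forall x t a K,
  K ((true, x) :: t) (a + v)%Z -> run f w ((true, x) :: t) a K.

Lemma passes_cat f u w v v' : passes f u v -> passes f w v' ->
  passes f (u ++ w) (v + v')%Z.
Proof.
move=> pu pw x t a K H; rewrite run_cat; apply: pu; apply: pw.
by rewrite -Z.add_assoc.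
Qed.

(** The sum telescopes to a difference of potentials between the two ends of the twist, where [e] is
    the same. *)
Lemma flat_passes_kink ls : odd (size ls) -> passes flat_indicator (kink ls) 0.
Proof.
move=> odd_ls x t a K H; apply/run_kink => //.
have [e end_e] := odd_twist_fixed odd_ls; exists e => //.
by rewrite flat_twist_value end_e Z.sub_diag.
Qed.

Lemma alter_cat n m u w w' : alter n m (u ++ w) w' ->
  exists n1 m1 n2 m2 u1 w1, [/\ w' = u1 ++ w1, alter n1 m1 u u1,
    alter n2 m2 w w1, n = n1 + n2 & m = m1 + m2].
Proof.
elim: u n m w' => [|x u IHu] n m w' /= alt.
  by exists 0, 0, n, m, [::], w'; split=> //; exact: alter_nil.
inversion alt as
    [|n0 m0 x0 w0 w1 alt1|n0 m0 b i w0 w1 alt1|n0 m0 b i w0 w1 alt1];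
  subst;
  have [n1 [m1 [n2 [m2 [u1 [w2 [-> altu altw -> ->]]]]]]] := IHu _ _ _ alt1.
- by exists n1, m1, n2, m2, (x :: u1), w2; split=> //; exact: alter_keep.
- exists n1.+1, m1, n2, m2, ((Cross Virtual, i) :: u1), w2; split=> //.
  exact: alter_virtualize.
- exists n1, m1.+1, n2, m2, ((Cross (Classical (~~ b)), i) :: u1), w2.
  split=> //.
  exact: alter_change.
Qed.

Lemma alter_keep_inv n m e i w w' : legs_below e <> legs_above e ->
  alter n m ((e, i) :: w) w' -> exists2 w1, w' = (e, i) :: w1 & alter n m w w1.
Proof.
move=> ne alt; inversion alt as [|n0 m0 x0 w0 w1 alt1| |]; subst => //.
by exists w1.
Qed.

(** [k = 0] is excluded because at [e = 0] a single crossing change can lower the value by 2. *)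
Definition dominated m (ls ls' : seq crossing) := forall k e, k <> 0%Z ->
  twist_end true ls' e = twist_end true ls e /\
  (twist_value (indicator k) true ls e - Z.of_nat m
     <= twist_value (indicator k) true ls' e)%Z.

Lemma alter_twist n m ls w' : alter n m (twist ls) w' ->
  exists ls', [/\ w' = twist ls', size ls' = size ls &
    n = 0 -> dominated m ls ls'].
Proof.
elim: ls n m w' => [|c ls IHls] n m w' /= alt.
  inversion alt; subst; exists [::]; split=> // _ k e _; split=> //=; lia.
inversion alt as
    [|n0 m0 x0 w0 w1 alt1|n0 m0 b i w0 w1 alt1|n0 m0 b i w0 w1 alt1];
  subst; have [ls' [-> size_ls' spec]] := IHls _ _ _ alt1.
- exists (c :: ls'); split=> //=; first by rewrite size_ls'.
  move=> n_eq0 k e k_neq0 /=.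
  have [-> ?] := spec n_eq0 k (crossing_act true c e) k_neq0.
  by split=> //; lia.
- by exists (Virtual :: ls'); split=> //=; rewrite size_ls'.
- exists (Classical (~~ b) :: ls'); split=> //=; first by rewrite size_ls'.
  move=> n_eq0 k e k_neq0 /=.
  have [-> ?] := spec n_eq0 k (- e)%Z k_neq0; split=> //.
  (* The change replaces [W] by [-W]; as [k] is nonzero, at most one of the two equals [k], so the
     loss is at most 1. *)
  suff: (sgn b * indicator k (sgn b * e) - 1
         <= sgn (~~ b) * indicator k (sgn (~~ b) * e))%Z by lia.
  by case: b {alt alt1}; rewrite /sgn /indicator /=;
    repeat case: Z.eqb_spec; lia.
Qed.

Lemma alter_nil_inv n m w' : alter n m [::] w' -> [/\ n = 0, m = 0 & w' = [::]].
Proof. by move=> alt; inversion alt. Qed.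

Lemma alter_kink n m ls w' : alter n m (kink ls) w' ->
  exists ls', [/\ w' = kink ls', size ls' = size ls &
    n = 0 -> dominated m ls ls'].
Proof.
move=> /alter_keep_inv[] // ? -> /alter_cat[n1 [m1 [n2 [m2 [u1 [w1]]]]]].
case=> -> /alter_twist[ls' [-> size_ls' spec]].
move=> /alter_keep_inv[] // w2 -> /alter_nil_inv[-> -> ->].
by rewrite !addn0 => -> ->; exists ls'.
Qed.

Lemma alter_cross_inv n m c i w w' : alter n m ((Cross c, i) :: w) w' ->
  exists c' n' m' w1, [/\ w' = (Cross c', i) :: w1, alter n' m' w w1 &
    n = (classical c && ~~ classical c') + n' /\
    (~~ classical c ==> ~~ classical c')].
Proof.
move=> alt; inversion alt as
  [|n0 m0 x0 w0 w1 alt1|n0 m0 b i0 w0 w1 alt1|n0 m0 b i0 w0 w1 alt1]; subst.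
- by exists c, n, m, w1; split=> //; case: c {alt}.
- by exists Virtual, n0, m, w1.
- by exists (Classical (~~ b)), n, m0, w1.
Qed.

Lemma alter_hooked_kinks n m w' :
  alter n m (hooked_kinks over_cross over_cross over_cross) w' ->
  exists x y z, w' = hooked_kinks x y z /\
    (n == 0) = [&& classical x, classical y & classical z].
Proof.
move=> /alter_keep_inv[] // ? ->.
move=> /alter_cross_inv[x [n1 [m1 [? [-> alt [-> _]]]]]].
move: alt => /alter_keep_inv[] // ? -> alt.
move: alt => /alter_cross_inv[y [n2 [m2 [? [-> alt [-> _]]]]]].
move: alt => /alter_cross_inv[v1 [n3 [m3 [? [-> alt [-> v1P]]]]]].
move: alt => /alter_cross_inv[z [n4 [m4 [? [-> alt [-> _]]]]]].
move: alt => /alter_cross_inv[v2 [n5 [m5 [? [-> alt [-> v2P]]]]]].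
move: alt => /alter_cross_inv[v3 [n6 [m6 [? [-> alt [-> v3P]]]]]].
move: alt => /alter_keep_inv[] // ? -> /alter_keep_inv[] // ? ->.
move=> /alter_nil_inv[-> _ ->]; exists x, y, z; move: v1P v2P v3P.
case: v1 => // _; case: v2 => // _; case: v3 => // _.
by split=> //; case: x; case: y; case: z.
Qed.

Lemma passes_hooked_kinks f x y z :
  passes f (hooked_kinks x y z) (hooked_value f x y z true).
Proof. by move=> l t a K H; apply/run_hooked_kinks. Qed.

(** Only [z] can have [W] equal to 4 or -4, and only when both chords that it meets are
    classical. *)
Lemma flat_hooked_value x y z :
  hooked_value flat_indicator x y z true =
  Z.b2z [&& classical x, classical y & classical z].
Proof. by case: x => [[]|]; case: y => [[]|]; case: z => [[]|]. Qed.

Lemma far_hooked_value k x y z o : (4 < k)%Z ->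
  hooked_value (indicator k) x y z o = 0%Z.
Proof.
move=> k_gt4; rewrite /hooked_value.
have far c e : (-4 <= e <= 4)%Z -> crossing_value (indicator k) c e = 0%Z.
  case: c => [b|] //= le_e; rewrite /indicator.
  by case: Z.eqb_spec; rewrite /sgn; case: b; lia.
by rewrite !far //; case: (classical x); case: (classical y);
  case: (classical z); case: o => /=; lia.
Qed.

Definition copies (n : nat) (w : word) : word := flatten (nseq n w).

(** With [k.+1] the clasp index is at least 6, out of reach of the hooked kinks, whose [W] stays
    between -4 and 4. *)
Definition pattern n m k : word :=
  copies n (hooked_kinks over_cross over_cross over_cross) ++
  copies m (kink (clasp k.+1 over_cross)).

Definition strand_closure w : word := (Cup, 0) :: w ++ [:: (Cap, 0)].

Lemma closed_value_strand_closure f w v :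
  passes f w v -> closed_value f (strand_closure w) v.
Proof.
move=> pw; exists (true, 0%Z); rewrite run_cat; apply: pw.
by split.
Qed.

Lemma passes_nil f : passes f [::] 0.
Proof. by move=> x t a K; rewrite Z.add_0_r. Qed.

(** Here [r] counts the copies that lose no crossing; each other copy uses up at least one
    virtualization. *)
Lemma alter_copies_hooked_kinks n a b w' :
  alter a b (copies n (hooked_kinks over_cross over_cross over_cross)) w' ->
  exists2 r, n <= r + a & passes flat_indicator w' (Z.of_nat r) /\
    forall k, (4 < k)%Z -> passes (indicator k) w' 0.
Proof.
elim: n a b w' => [|n IHn] a b w'.
  by move=> /alter_nil_inv[_ _ ->]; exists 0; split=> [|k _]; exact: passes_nil.
move=> /alter_cat[a1 [b1 [a2 [b2 [u [w1 [-> ]]]]]]].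
move=> /alter_hooked_kinks[x [y [z [-> a1E]]]].
move=> /IHn[r le_n [flat_w1 far_w1]] -> _.
exists ((a1 == 0) + r); first by move: le_n; case: eqP; lia.
split.
  have -> : (Z.of_nat ((a1 == 0) + r)%nat =
             hooked_value flat_indicator x y z true + Z.of_nat r)%Z.
    by rewrite flat_hooked_value -a1E Nat2Z.inj_add; case: eqP.
  by apply: passes_cat => //; apply: passes_hooked_kinks.
move=> k k_gt4; rewrite -(Z.add_0_r 0) -{1}(far_hooked_value x y z true k_gt4).
by apply: passes_cat; [apply: passes_hooked_kinks | apply: far_w1].
Qed.

Lemma alter_copies_clasp m k a b w' :
  alter a b (copies m (kink (clasp k over_cross))) w' ->
  passes flat_indicator w' 0 /\
  (a = 0 -> exists2 v, (Z.of_nat m <= v + Z.of_nat b)%Z &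
     passes (indicator (clasp_index k)) w' v).
Proof.
elim: m a b w' => [|m IHm] a b w'.
  move=> /alter_nil_inv[_ _ ->]; split=> [|_]; first exact: passes_nil.
  by exists 0%Z; [lia | exact: passes_nil].
move=> /alter_cat[a1 [b1 [a2 [b2 [u [w1 [-> ]]]]]]].
move=> /alter_kink[ls [-> size_ls spec]] /IHm[flat_w1 ind_w1] -> ->.
have odd_ls : odd (size ls) by rewrite size_ls odd_clasp.
split; first exact: (passes_cat (flat_passes_kink odd_ls) flat_w1).
move=> /eqP; rewrite addn_eq0 => /andP[/eqP a1_0 /eqP /ind_w1[v le_m pv]].
have k_neq0 : clasp_index k <> 0%Z by rewrite /clasp_index; lia.
(* Crossing changes do not move the fixed point, so the altered clasp is still coloured with
   [e = 2]. *)
have [end_ls val_ls] := spec a1_0 (clasp_index k) 2%Z k_neq0.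
exists (twist_value (indicator (clasp_index k)) true ls 2 + v)%Z.
  move: val_ls; rewrite -[2%Z]/(2 * sgn true)%Z twist_value_clasp.
  rewrite /indicator Z.eqb_refl.
  by case: Z.eqb_spec; rewrite /clasp_index; lia.
apply: passes_cat => // x t c K H; apply/run_kink => //; exists 2%Z => //=.
rewrite end_ls /clasp -cats1 twist_end_cat twist_end_conjugated //= => e.
by lia.
Qed.

Lemma unknottable_bound (D : virtual_knot_diagram) n m k a b :
  diagram_word D = strand_closure (pattern n m k) -> unknottable D a b ->
  n < a \/ (n = a /\ m <= b).
Proof.
move=> DE [D' []]; rewrite DE => /alter_keep_inv[] // w0 D'E.
move=> /alter_cat[a1 [b1 [a2 [b2 [u [w1 [w0E]]]]]]].
move=> /alter_cat[a3 [b3 [a4 [b4 [u3 [u4 [uE]]]]]]].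
move=> /alter_copies_hooked_kinks[r le_n [flat_u3 far_u3]].
move=> /alter_copies_clasp[flat_u4 ind_u4] a1E b1E.
move=> /alter_keep_inv[] // w2 w1E /alter_nil_inv[a2E b2E w2E] aE bE trivD'.
have D'word : diagram_word D' = strand_closure (u3 ++ u4).
  by rewrite D'E w0E w1E w2E uE.
(* The trivial diagram has only the value 0, while [D'] attains [r]. *)
have r0: r = 0.
  suff /(closed_value_trivial (f := flat_indicator) erefl trivD') :
    closed_value flat_indicator D' (Z.of_nat r + 0) by lia.
  by rewrite D'word; apply: closed_value_strand_closure; exact: passes_cat.
(* A virtualization spent on a clasp comes on top of the [n] or more spent on the hooked kinks. *)
have [a4_0|a4_gt0] := posnP a4; last by left; lia.
have [v le_m ind_v] := ind_u4 a4_0.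
have ind0 : indicator (clasp_index k.+1) 0 = 0%Z.
  by rewrite /indicator; case: Z.eqb_spec; rewrite /clasp_index; lia.
have triv := closed_value_trivial (v := (0 + v)%Z) ind0 trivD'.
have v0: (0 + v)%Z = 0%Z.
  apply: triv; rewrite D'word; apply: closed_value_strand_closure.
  apply: passes_cat => //.
  by apply: far_u3; rewrite /clasp_index; lia.
lia.
Qed.

(** * Removing bigons and kinks *)

Definition joined w : relation point := clos_refl_sym_trans point (Defs.arc w).

(* Whether two points are joined by an arc depends only on one event. *)
Lemma arc_transport w x y : Defs.arc w x y ->
  exists u e v d d' p q, [/\ w = u ++ e :: v, d <= 1 /\ d' <= 1,
    x = (size u + d, p), y = (size u + d', q) &
    forall u' v', Defs.arc (u' ++ e :: v') (size u' + d, p) (size u' + d', q)].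
Proof.
case=> {x y} u.
- move=> e i v p -> lt_pi; exists u, (e, i), v, 0, 1, p, p.
  split; rewrite ?addn0 ?addn1 // => u' v'; rewrite addn0 addn1.
  exact: arc_left.
- move=> e i v k ->.
  exists u, (e, i), v, 0, 1, (i + legs_below e + k), (i + legs_above e + k).
  split; rewrite ?addn0 ?addn1 // => u' v'; rewrite addn0 addn1.
  exact: arc_right.
- move=> i v ->; exists u, (Cup, i), v, 1, 1, i, i.+1.
  split; rewrite ?addn0 ?addn1 // => u' v'; rewrite ?addn0 addn1.
  exact: arc_cup.
- move=> i v ->; exists u, (Cap, i), v, 0, 0, i, i.+1.
  split; rewrite ?addn0 ?addn1 // => u' v'; rewrite ?addn0 ?addn1.
  exact: arc_cap.
- move=> c i v ->; exists u, (Cross c, i), v, 0, 1, i, i.+1.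
  split; rewrite ?addn0 ?addn1 // => u' v'; rewrite ?addn0 ?addn1.
  exact: arc_up_right.
- move=> c i v ->; exists u, (Cross c, i), v, 0, 1, i.+1, i.
  split; rewrite ?addn0 ?addn1 // => u' v'; rewrite ?addn0 ?addn1.
  exact: arc_up_left.
Qed.

Lemma cat_cons_split (T : Type) (u v u0 v0 : seq T) e :
  u ++ v = u0 ++ e :: v0 ->
  (exists v1, u = u0 ++ e :: v1 /\ v0 = v1 ++ v) \/
  (exists u1, v = u1 ++ e :: v0 /\ u0 = u ++ u1).
Proof.
elim: u u0 => [|x u IHu] [|x0 u0] /=.
- by move=> ->; right; exists [::].
- by move=> ->; right; exists (x0 :: u0).
- by case=> -> <-; left; exists u.
- case=> -> /IHu[[v1 [-> ->]]|[u1 [-> ->]]]; first by left; exists v1.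
  by right; exists u1.
Qed.

(** The curve stays connected if each strand runs through [l] back to its own position and each
    point within [l] is joined to a strand entering from below. *)
Lemma one_circle_insert u l v n :
  let w := u ++ l ++ v in
  strands_above 0 u = Some n -> strands_above n l = Some n ->
  (forall p, joined w (size u, p) (size u + size l, p)) ->
  (forall h n' p, h <= size l -> strands_above n (take h l) = Some n' ->
     p < n' -> exists2 p', p' < n & joined w (size u + h, p) (size u, p')) ->
  one_circle (u ++ v) -> one_circle w.
Proof.
move=> w un ln through inner [[x0 on_x0] conn].
(* Points at height [size u] are sent to the bottom of [l]; [through] identifies them with the
   top. *)
pose phi (x : point) : point :=
  if x.1 <= size u then x else (x.1 + size l, x.2).
have phi_above h p : size u <= h -> joined w (phi (h, p)) (h + size l, p).
  move=> le_uh; rewrite /phi /=; case: leqP => le_hu; last exact: rst_refl.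
  by have -> : h = size u by lia.
have phi_arc x y : Defs.arc (u ++ v) x y -> joined w (phi x) (phi y).
  move=> /arc_transport[u0 [e [v0 [d [d' [p [q]]]]]]].
  case=> uvE [dle d'le] -> -> arcs.
  have [[v1 [uE v0E]]|[u1 [vE u0E]]] := cat_cons_split uvE.
    rewrite /phi /= uE size_cat /= !ifT; try lia.
    by apply: rst_step; rewrite /w uE -catA cat_cons.
  have le_u: size u <= size u0 by rewrite u0E size_cat; lia.
  apply: (rst_trans _ _ _ (size u0 + d + size l, p)).
    by apply: phi_above; lia.
  apply: (rst_trans _ _ _ (size u0 + d' + size l, q)); last first.
    by apply: rst_sym; apply: phi_above; lia.
  apply: rst_step.
  have := arcs (u ++ l ++ u1) v0; rewrite -!catA -vE u0E !size_cat.
  have E d1 : size u + size u1 + d1 + size l =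
              size u + (size l + size u1) + d1 by lia.
  by rewrite !E.
have phi_joined x y : joined (u ++ v) x y -> joined w (phi x) (phi y).
  elim=> {x y} [x y /phi_arc //|x|x y _ xy|x y z _ xy _ yz].
  - exact: rst_refl.
  - exact: rst_sym.
  - exact: rst_trans xy yz.
have pull x : on_curve w x ->
    exists2 x', on_curve (u ++ v) x' & joined w x (phi x').
  case: x => h p [/= le_h [n' hn' lt_p]].
  have [le_hu|lt_uh] := leqP h (size u).
    exists (h, p); last by rewrite /phi /= le_hu; exact: rst_refl.
    split; first by rewrite /= size_cat; lia.
    by exists n' => //; move: hn'; rewrite /w !takel_cat.
  have [le_hl|lt_lh] := leqP h (size u + size l).
    have [||p' lt_p' jp] := inner (h - size u) n' p _ _ lt_p.
    - lia.
    - move: hn'; rewrite /w take_cat ltnNge (ltnW lt_uh) /=.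
      rewrite strands_above_cat un /=.
      by rewrite takel_cat //; lia.
    exists (size u, p'); last first.
      by rewrite /phi /= leqnn; move: jp; rewrite subnKC // ltnW.
    split; first by rewrite /= size_cat; lia.
    by exists n; rewrite //= take_size_cat.
  exists (h - size l, p); last first.
    by rewrite /phi /= ifF ?subnK; [exact: rst_refl | lia | lia].
  split; first by move: le_h; rewrite /w /= !size_cat; lia.
  exists n' => //=; move: hn'; rewrite /w catA.
  rewrite take_cat size_cat ifF; last lia.
  rewrite take_cat ifF; last lia.
  rewrite !strands_above_cat un /= ln /=.
  by congr (_ = _); congr strands_above; congr take; lia.
split.
  case: x0 {conn} on_x0 => h p [/= le_h [n' hn' lt_p]].
  have [le_hu|lt_uh] := leqP h (size u).
    exists (h, p); split; first by rewrite /w /= !size_cat; lia.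
    by exists n' => //; move: hn'; rewrite /w /= !takel_cat.
  exists (h + size l, p).
  split; first by move: le_h; rewrite /w /= !size_cat; lia.
  exists n' => //=; move: hn'; rewrite /w catA take_cat ifF; last lia.
  rewrite take_cat size_cat ifF; last lia.
  rewrite !strands_above_cat un /= ln /=.
  by move=> <-; congr strands_above; congr take; lia.
move=> x y /pull[x' /conn cx jx] /pull[y' /cx cxy jy].
apply: rst_trans jx (rst_trans _ _ _ _ _ (phi_joined _ _ cxy) _).
exact: rst_sym.
Qed.

(** * Inserting bigons and kinks keeps one circle *)

Definition swapped i p := if p == i then i.+1 else if p == i.+1 then i else p.

Lemma swappedK i : involutive (swapped i).
Proof. by move=> p; rewrite /swapped; do !case: eqP; lia. Qed.

Lemma arc_cross u c i v p :
  Defs.arc (u ++ (Cross c, i) :: v) (size u, p) ((size u).+1, swapped i p).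
Proof.
rewrite /swapped; case: eqP => [->|ne_i]; first exact: arc_up_right.
case: eqP => [->|ne_i1]; first exact: arc_up_left.
have [lt_pi|le_ip] := ltnP p i; first exact: arc_left.
have -> : p = i + 2 + (p - i - 2) by lia.
exact: (@arc_right _ u (Cross c) i v).
Qed.

Lemma arc_over_cup u i v p :
  Defs.arc (u ++ (Cup, i) :: v)
    (size u, p) ((size u).+1, if p < i then p else p.+2).
Proof.
case: ltnP => [lt_pi|le_ip]; first exact: arc_left.
have := @arc_right (u ++ (Cup, i) :: v) u Cup i v (p - i) erefl.
by rewrite /= addn0 subnKC // -addnA addnCA subnKC // add2n.
Qed.

Lemma arc_under_cap u i v p :
  Defs.arc (u ++ (Cap, i) :: v)
    (size u, if p < i then p else p.+2) ((size u).+1, p).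
Proof.
case: ltnP => [lt_pi|le_ip]; first exact: arc_left.
have := @arc_right (u ++ (Cap, i) :: v) u Cap i v (p - i) erefl.
by rewrite /= addn0 subnKC // -addnA addnCA subnKC // add2n.
Qed.

Lemma one_circle_bigon u v c c' i n : strands_above 0 u = Some n -> i.+1 < n ->
  one_circle (u ++ v) ->
  one_circle (u ++ [:: (Cross c, i); (Cross c', i)] ++ v).
Proof.
move=> un lt_in; set w := u ++ _ ++ v.
have lower p : joined w (size u, p) ((size u).+1, swapped i p).
  exact/rst_step/arc_cross.
have upper p : joined w ((size u).+1, p) ((size u).+2, swapped i p).
  have := arc_cross (u ++ [:: (Cross c, i)]) c' i v p.
  by rewrite -catA size_cat addn1 => ?; apply: rst_step.
have through p : joined w (size u, p) (size u + 2, p).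
  by rewrite addn2 -{2}(swappedK i p); apply: rst_trans (lower _) (upper _).
apply: (one_circle_insert un) => //=.
  by rewrite !ifT; try congr Some; lia.
case=> [|[|[|h]]] n' p // _ /=.
- by rewrite addn0 => -[->] lt_p; exists p => //; exact: rst_refl.
- case: ifP => // _ [<-] lt_p; exists (swapped i p).
    by rewrite /swapped; do !case: eqP; lia.
  by rewrite addn1 -{1}(swappedK i p); exact/rst_sym/lower.
- rewrite ifT; last lia.
  by case: ifP => // _ [<-] lt_p; exists p; [lia | exact/rst_sym/through].
Qed.

Lemma one_circle_kink_right u v c i n : strands_above 0 u = Some n -> i < n ->
  one_circle (u ++ v) -> one_circle (u ++ kink_right c i ++ v).
Proof.
move=> un lt_in; set w := u ++ _ ++ v.
have level1 p :
    joined w (size u, p) ((size u).+1, if p < i.+1 then p else p.+2).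
  exact/rst_step/arc_over_cup.
have cup : joined w ((size u).+1, i.+1) ((size u).+1, i.+2).
  exact/rst_step/(@arc_cup _ u i.+1).
have level2 p : joined w ((size u).+1, p) ((size u).+2, swapped i p).
  have := arc_cross (u ++ [:: (Cup, i.+1)]) c i ((Cap, i.+1) :: v) p.
  by rewrite -catA size_cat addn1 => ?; apply: rst_step.
have level3 p :
    joined w ((size u).+2, if p < i.+1 then p else p.+2) ((size u).+3, p).
  have := arc_under_cap (u ++ [:: (Cup, i.+1); (Cross c, i)]) i.+1 v p.
  by rewrite -catA size_cat addn2 => ?; apply: rst_step.
have cap : joined w ((size u).+2, i.+1) ((size u).+2, i.+2).
  have := @arc_cap w (u ++ [:: (Cup, i.+1); (Cross c, i)]) i.+1 v.
  by rewrite -catA size_cat addn2 => H; apply/rst_step/H.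
(* The strand climbs through the crossing, turns at the cap and descends to the right leg of the
   cup; [through] then completes its way up. *)
have loop : joined w (size u, i) ((size u).+1, i.+2).
  have H1 := level1 i; rewrite ltnSn in H1; apply: rst_trans H1 _.
  have H2 := level2 i; rewrite /swapped eqxx in H2; apply: rst_trans H2 _.
  apply: rst_trans cap _; apply: rst_sym.
  by have := level2 i.+2; rewrite /swapped !ifF //; lia.
have through p : joined w (size u, p) (size u + 3, p).
  rewrite addn3; have [eq_pi|ne_pi] := eqVneq p i.
    rewrite eq_pi; apply: rst_trans loop _.
    apply: rst_trans (rst_sym _ _ _ _ cup) _.
    have H2 := level2 i.+1; rewrite /swapped eqxx ifF in H2; last lia.
    by apply: rst_trans H2 _; have := level3 i; rewrite ltnSn.
  apply: rst_trans (level1 p) (rst_trans _ _ _ _ _ _ (level3 p)).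
  have := level2 (if p < i.+1 then p else p.+2); rewrite /swapped.
  by case: ltnP => ?; rewrite !ifF //; lia.
have inner1 p : p < n.+2 ->
    exists2 p', p' < n & joined w ((size u).+1, p) (size u, p').
  move=> lt_p; have [le_pi|lt_ip] := leqP p i.
    exists p; first lia.
    by have H1 := level1 p; rewrite ltnS le_pi in H1; exact: rst_sym.
  have [eq1|ne1] := eqVneq p i.+1.
    exists i; rewrite // eq1; apply: rst_trans cup _; exact: rst_sym.
  have [eq2|ne2] := eqVneq p i.+2.
    by exists i; rewrite // eq2; exact: rst_sym.
  exists (p - 2); first lia.
  have H1 := level1 (p - 2); rewrite ifF in H1; last lia.
  have p2 : (p - 2).+2 = p by lia.
  by rewrite p2 in H1; exact: rst_sym.
apply: (one_circle_insert un) => //=.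
  by rewrite !ifT; try congr Some; lia.
case=> [|[|[|[|h]]]] n' p // _ /=.
- by rewrite addn0 => -[->] lt_p; exists p => //; exact: rst_refl.
- case: ifP => // _ [<-] lt_p; rewrite addn1; apply: inner1; lia.
- rewrite ifT; last lia.
  case: ifP => // _ [<-] lt_p; rewrite addn2.
  have [|p' lt_p' jp'] := inner1 (swapped i p).
    by rewrite /swapped; do !case: eqP; lia.
  exists p' => //; apply: rst_trans jp'.
  by rewrite -{1}(swappedK i p); apply/rst_sym/level2.
- rewrite !ifT; try lia.
  by case=> <- lt_p; exists p; [lia | exact/rst_sym/through].
Qed.

Inductive removable (n : nat) : word -> Prop :=
| removable_bigon c i : i.+1 < n ->
    removable n [:: (Cross c, i); (Cross (swap_over c), i)]
| removable_kink c i : i < n -> removable n (kink_right c i).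

Lemma strands_above_removable n l : removable n l -> strands_above n l = Some n.
Proof. by case=> c i lt_in /=; rewrite !ifT; try congr Some; lia. Qed.

Lemma one_circle_removable u l v n : strands_above 0 u = Some n ->
  removable n l -> one_circle (u ++ v) -> one_circle (u ++ l ++ v).
Proof.
move=> un [] c i lt_in; first exact: one_circle_bigon un lt_in.
exact: one_circle_kink_right un lt_in.
Qed.

Lemma reidemeister_removable n l : removable n l -> reidemeister_move l [::].
Proof.
case=> c i _; case: c => [b|] /=.
- exact: RII.
- exact: VRII.
- exact: RI_right.
- exact: VRI_right.
Qed.

(** Built up from the circle, so that each insertion also yields the closedness and connectivity
    that a diagram must carry. *)
Inductive collapses : word -> Prop :=
| collapses_circle : collapses circle_word
| collapses_insert u l v n : strands_above 0 u = Some n -> removable n l ->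
    collapses (u ++ v) -> collapses (u ++ l ++ v).

Lemma collapses_trivial w : collapses w ->
  exists2 D, diagram_word D = w & equivalent D trivial_diagram.
Proof.
elim=> [|u l v n un rem _ [D Dw trivD]].
  by exists trivial_diagram => //; exact: rst_refl.
have closed_w : closed_word (u ++ l ++ v).
  have := diagram_closed D; rewrite Dw /closed_word !strands_above_cat un /=.
  by rewrite strands_above_cat (strands_above_removable rem).
have one_w : one_circle (u ++ l ++ v).
  apply: one_circle_removable un rem _; rewrite -Dw.
  exact: diagram_one_circle.
exists (VirtualKnotDiagram closed_w one_w) => //.
apply: rst_trans trivD; apply: rst_step.
apply: (@local_move _ _ u l [::] v) => //.
by right; exact: reidemeister_removable rem.
Qed.

Definition dissolves n g := forall u v,
  strands_above 0 u = Some n -> collapses (u ++ v) -> collapses (u ++ g ++ v).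

(** Once [z] is virtual, the four inner crossings form two nested virtual bigons; without them a
    kink within a kink remains. The insertions go from the outside inwards. *)
Lemma dissolves_hooked_kinks :
  dissolves 2 (hooked_kinks over_cross over_cross Virtual).
Proof.
move=> u v u2 /(collapses_insert u2 (@removable_kink 2 over_cross 0 isT)) H.
have after p : strands_above 0 (u ++ p) = strands_above 2 p.
  by rewrite strands_above_cat u2.
pose p1 := [:: (Cup, 1); (Cross over_cross, 0)].
have := @collapses_insert (u ++ p1) _ ((Cap, 1) :: v) 4 (after _)
  (@removable_kink 4 over_cross 1 isT).
rewrite -!catA => /(_ H) {}H.
pose p2 := p1 ++ [:: (Cup, 2); (Cross over_cross, 1)].
have := @collapses_insert (u ++ p2) _ [:: (Cap, 2), (Cap, 1) & v] 6 (after _)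
  (@removable_bigon 6 Virtual 0 isT).
rewrite -!catA => /(_ H) {}H.
pose p3 := p2 ++ [:: (Cross Virtual, 0)].
have := @collapses_insert (u ++ p3) _
  [:: (Cross Virtual, 0), (Cap, 2), (Cap, 1) & v] 6 (after _)
  (@removable_bigon 6 Virtual 1 isT).
by rewrite -!catA => /(_ H).
Qed.

Lemma twist_cat u v : twist (u ++ v) = twist u ++ twist v.
Proof. exact: map_cat. Qed.

(** Read from the middle outwards, the twist consists of nested bigons. *)
Lemma dissolves_conjugated k n : 1 < n ->
  dissolves n (twist (conjugated k [:: over_cross; Classical false])).
Proof.
move=> n_gt1; elim: k => [|k IHk] u v un uv.
  exact: collapses_insert un (@removable_bigon n over_cross 0 n_gt1) uv.
have := collapses_insert un (@removable_bigon n over_cross 0 n_gt1) uv.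
have un1: strands_above 0 (u ++ twist [:: over_cross]) = Some n.
  by rewrite strands_above_cat un /= ifT; try congr Some; lia.
have := @collapses_insert _ _ (twist [:: Classical false] ++ v) n un1
  (@removable_bigon n Virtual 0 n_gt1).
rewrite -!catA => H /H {}H.
have un2: strands_above 0 (u ++ twist [:: over_cross; Virtual]) = Some n.
  by rewrite strands_above_cat un /= !ifT; try congr Some; lia.
have := IHk _ (twist [:: Virtual; Classical false] ++ v) un2.
by rewrite -!catA => /(_ H); rewrite /= twist_cat -catA.
Qed.

Lemma strands_above_kink ls : strands_above 2 (kink ls) = Some 2.
Proof.
rewrite /= strands_above_cat.
have -> : strands_above 4 (twist ls) = Some 4 by elim: ls.
by [].
Qed.

(** Without its nested bigons the clasp is a kink with a single virtual crossing. *)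
Lemma dissolves_clasp k : dissolves 2 (kink (clasp k (Classical false))).
Proof.
move=> u v u2 /(collapses_insert u2 (@removable_kink 2 Virtual 0 isT)) H.
have u4: strands_above 0 (u ++ [:: (Cup, 1)]) = Some 4.
  by rewrite strands_above_cat u2.
have := @dissolves_conjugated k 4 isT _
  [:: (Cross Virtual, 0), (Cap, 1) & v] u4.
rewrite -!catA => /(_ H).
by rewrite /kink /clasp -cats1 twist_cat /= -!catA.
Qed.

Lemma dissolves_copies n w k : strands_above k w = Some k ->
  dissolves k w -> dissolves k (copies n w).
Proof.
move=> wk dw; elim: n => [|n IHn] u v uk uv //.
rewrite /copies /= -catA; apply: dw => //; exact: IHn.
Qed.

(** * Alterations that unknot the pattern *)

Lemma alter_refl w : alter 0 0 w w.
Proof. by elim: w => [|x w]; [exact: alter_nil | exact: alter_keep]. Qed.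

Lemma alter_append n m n' m' u u' w w' : alter n m u u' -> alter n' m' w w' ->
  alter (n + n') (m + m') (u ++ w) (u' ++ w').
Proof.
move=> alt alt_w.
elim: alt => //= {n m u u'} [n m x u u'|n m b i u u'|n m b i u u'] _.
- exact: alter_keep.
- exact: alter_virtualize.
- exact: alter_change.
Qed.

Lemma alter_copies k n m w w' : alter n m w w' ->
  alter (k * n) (k * m) (copies k w) (copies k w').
Proof.
move=> alt; elim: k => [|k IHk]; first exact: alter_nil.
by rewrite !mulSn; apply: alter_append.
Qed.

Lemma alter_conjugated k : alter 0 1
  (twist (conjugated k [:: over_cross; over_cross]))
  (twist (conjugated k [:: over_cross; Classical false])).
Proof.
elim: k => [|k IHk].
  by apply: alter_keep; apply: alter_change; exact: alter_nil.
rewrite /= !twist_cat; do 2!apply: alter_keep.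
exact: (alter_append IHk (alter_refl _)).
Qed.

Lemma alter_clasp k :
  alter 0 1 (kink (clasp k over_cross)) (kink (clasp k (Classical false))).
Proof.
rewrite /kink /clasp -!cats1 !twist_cat; apply: alter_keep; rewrite -!catA.
exact: (alter_append (alter_conjugated k) (alter_refl _)).
Qed.

Lemma alter_pattern n m k :
  alter n m (strand_closure (pattern n m k))
  (strand_closure (copies n (hooked_kinks over_cross over_cross Virtual) ++
                   copies m (kink (clasp k.+1 (Classical false))))).
Proof.
apply: alter_keep.
have altA : alter 1 0 (hooked_kinks over_cross over_cross over_cross)
    (hooked_kinks over_cross over_cross Virtual).
  (* The sixth event is the crossing [z]. *)
  do 5!apply: alter_keep; apply: alter_virtualize; exact: alter_refl.
have altB := alter_copies m (alter_clasp k.+1).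
have := alter_append (alter_append (alter_copies n altA) altB)
  (alter_refl [:: (Cap, 0)]).
by rewrite !muln1 !muln0 !addn0.
Qed.

Lemma alter_split n m w u e i v : alter n m w (u ++ (e, i) :: v) ->
  exists u' e' v', [/\ w = u' ++ (e', i) :: v', size u' = size u &
    if e is Cross _ then exists c, e' = Cross c else e' = e].
Proof.
elim: u n m w => [|x u IHu] n m w /= alt.
  inversion alt; subst; eexists [::], _, _; split=> //.
  - by case: e {alt} => // c; exists c.
  - by eexists.
  - by eexists.
by inversion alt as
    [|n0 m0 x0 w0 w1 alt1|n0 m0 b j w0 w1 alt1|n0 m0 b j w0 w1 alt1];
  subst; have [u' [e' [v' [-> <- eqe]]]] := IHu _ _ _ alt1;
  [exists (x :: u') | exists ((Cross (Classical b), j) :: u')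
    | exists ((Cross (Classical b), j) :: u')];
  exists e', v'.
Qed.

Lemma arc_alter n m w w' x y :
  alter n m w w' -> Defs.arc w' x y -> Defs.arc w x y.
Proof.
move=> alt xy; case: xy alt => {x y} u.
- move=> e i v p -> lt_pi /alter_split[u' [e' [v' [-> <- _]]]]; exact: arc_left.
- move=> e i v k -> /alter_split[u' [e' [v' [-> <- eqe]]]].
  have [-> ->] : legs_below e = legs_below e' /\ legs_above e = legs_above e'.
    by case: e eqe => [->|->|c [c' ->]].
  exact: arc_right.
- move=> i v -> /alter_split[u' [e' [v' [-> <- ->]]]]; exact: arc_cup.
- move=> i v -> /alter_split[u' [e' [v' [-> <- ->]]]]; exact: arc_cap.
- move=> c i v -> /alter_split[u' [e' [v' [-> <- [c' ->]]]]].
  exact: arc_up_right.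
- move=> c i v -> /alter_split[u' [e' [v' [-> <- [c' ->]]]]].
  exact: arc_up_left.
Qed.

Lemma strands_above_alter n m w w' h k : alter n m w w' ->
  strands_above k (take h w) = strands_above k (take h w').
Proof.
move=> alt; elim: alt h k => //= {n m w w'}
  [n m x w w' _ IHw|n m b i w w' _ IHw|n m b i w w' _ IHw] [|h] k //=.
- by case: x => e i; rewrite IHw.
- by rewrite IHw.
- by rewrite IHw.
Qed.

Lemma size_alter n m w w' : alter n m w w' -> size w = size w'.
Proof. by elim=> //= *; congr S. Qed.

Lemma closed_word_alter n m w w' :
  alter n m w w' -> closed_word w' -> closed_word w.
Proof.
move=> alt; have := strands_above_alter (size w) 0 alt.
by rewrite take_size (size_alter alt) take_size /closed_word => ->.
Qed.

(** Altering crossings leaves the underlying curve unchanged. *)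
Lemma one_circle_alter n m w w' :
  alter n m w w' -> one_circle w' -> one_circle w.
Proof.
move=> alt [[x on_x] conn].
have on_w y : on_curve w y <-> on_curve w' y.
  by rewrite /on_curve (size_alter alt) (strands_above_alter _ _ alt).
split; first by exists x; apply/on_w.
move=> y z /on_w on_y /on_w on_z.
elim: (conn y z on_y on_z) => {y z on_y on_z}
  [y z /(arc_alter alt)|y|y z _|y z t _ yz _ zt].
- exact: rst_step.
- exact: rst_refl.
- exact: rst_sym.
- exact: rst_trans yz zt.
Qed.

Lemma pattern_unknots n m k :
  exists2 D, alter n m (strand_closure (pattern n m k)) (diagram_word D) &
    equivalent D trivial_diagram.
Proof.
have [|D Dw trivD] := @collapses_trivial
  (strand_closure (copies n (hooked_kinks over_cross over_cross Virtual) ++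
            copies m (kink (clasp k.+1 (Classical false))))).
  rewrite /strand_closure -catA -cat1s.
  apply: (dissolves_copies n _ dissolves_hooked_kinks) => //.
  apply: (dissolves_copies m _ (@dissolves_clasp _)) => //.
    exact: strands_above_kink.
  exact: collapses_circle.
by exists D; rewrite ?Dw //; exact: alter_pattern.
Qed.

(** Inherited from the unknotted alteration, which is a diagram by its construction from the
    circle. *)
Lemma pattern_closed n m k : closed_word (strand_closure (pattern n m k)).
Proof.
have [D /closed_word_alter closed_D _] := pattern_unknots n m k.
exact/closed_D/diagram_closed.
Qed.

Lemma pattern_one_circle n m k : one_circle (strand_closure (pattern n m k)).
Proof.
have [D /one_circle_alter one_D _] := pattern_unknots n m k.
exact/one_D/diagram_one_circle.
Qed.

Definition pattern_diagram n m k : virtual_knot_diagram :=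
  VirtualKnotDiagram (pattern_closed n m k) (pattern_one_circle n m k).

(** * The family *)

(** The two-sided form of [passes], for either orientation: telling diagrams apart requires showing
    that a value is not attained. *)
Definition rigid f w v := forall c t a K,
  run f w (c :: t) a K <-> K (c :: t) (a + v)%Z.

Lemma rigid_cat f u w v v' : rigid f u v -> rigid f w v' ->
  rigid f (u ++ w) (v + v').
Proof.
by move=> ru rw c t a K; rewrite run_cat (ru c t a _) (rw c t _ K) Z.add_assoc.
Qed.

Lemma rigid_copies f n w v :
  rigid f w v -> rigid f (copies n w) (Z.of_nat n * v).
Proof.
move=> rw; elim: n => [|n IHn]; first by move=> c t a K; rewrite Z.add_0_r.
rewrite Nat2Z.inj_succ Z.mul_succ_l Z.add_comm; exact: (rigid_cat rw IHn).
Qed.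

Lemma closed_value_rigid f w v x : rigid f w v ->
  closed_value f (strand_closure w) x <-> x = v.
Proof.
move=> rw; split=> [[c /run_cat/rw/=[_ [_ <-]] //]|->].
by exists (true, 0%Z); apply/run_cat/rw.
Qed.

(** Each clasp has one crossing with [W = clasp_index k.+1] and one with the opposite [W], which is
    negative and so never counted. *)
Lemma closed_value_pattern n m j k x :
  closed_value (indicator (clasp_index j.+1))
    (strand_closure (pattern n m k)) x <->
  x = if j == k then Z.of_nat m else 0%Z.
Proof.
set f := indicator _.
have rA : rigid f (hooked_kinks over_cross over_cross over_cross) 0.
  move=> c t a K; rewrite run_hooked_kinks far_hooked_value //.
  by rewrite /clasp_index; lia.
have rB := fun c t a K => @run_clasp f k.+1 c t a K.
rewrite (closed_value_rigid _
  (rigid_cat (rigid_copies n rA) (rigid_copies m rB))).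
have -> : (f (clasp_index k.+1) + f (- clasp_index k.+1) = Z.b2z (j == k))%Z.
  rewrite /f /indicator /clasp_index.
  by case: (j =P k) => [->|ne_jk]; do 2!case: Z.eqb_spec => ?; lia.
by rewrite Z.mul_0_r; case: (j == k); rewrite ?Z.mul_1_r ?Z.mul_0_r.
Qed.

Theorem theorem3p3 (n m : nat) (hn : 0 < n) (hm : 0 < m) :
  exists D : nat -> virtual_knot_diagram,
    (forall j k : nat, j <> k -> ~ equivalent (D j) (D k)) /\
    (forall k : nat, unknotting_index (D k) (n, m)).
Proof.
exists (pattern_diagram n m); split=> [j k ne_jk equiv_jk | k].
  have f0 : indicator (clasp_index j.+1) 0 = 0%Z.
    by rewrite /indicator; case: Z.eqb_spec; rewrite /clasp_index; lia.
  have := closed_value_equivalent (Z.of_nat m) f0 equiv_jk.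
  (* The [j]-th diagram attains the value [m], the [k]-th only 0, and [m] is positive. *)
  by rewrite !closed_value_pattern eqxx; case: eqP => // _ [/(_ erefl)]; lia.
split; first by have [D alt_D triv_D] := pattern_unknots n m k; exists D.
case=> a b /(@unknottable_bound (pattern_diagram n m k) n m k _ _ erefl) bound.
rewrite Order.ProdLexiOrder.leEprodlexi !Order.NatOrder.leEnat /=.
case: bound => /= [lt_na|[-> ->]]; first by rewrite ltnW //= leqNgt lt_na.
by rewrite leqnn implybT.
Qed.
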